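(* Let $G$ be a nontrivial connected graph. Then $\mathrm{srd}(G)=1$ if and only if $\mathrm{rd}(G)=1$.
   Context: All graphs are simple, finite and undirected. An edge-coloring of $G$ is any map $c:E(G)\to[k]$ (adjacent edges may receive the same color). For distinct vertices $u,v$ of a connected graph $G$, a $u$-$v$-edge-cut is a set $F$ of edges such that $u$ and $v$ lie in different components of $G-F$; a minimum $u$-$v$-edge-cut is one of minimum size among these. A set of edges is rainbow if no two of its edges have the same color. An edge-colored connected graph is rainbow disconnected if for every two distinct vertices $u,v$ there is a rainbow $u$-$v$-edge-cut; $\mathrm{rd}(G)$ is the smallest number of colors of an edge-coloring making $G$ rainbow disconnected. An edge-colored connected graph is strong rainbow disconnected if for every two distinct vertices $u,v$ there is a $u$-$v$-edge-cut that is both rainbow and minimum; $\mathrm{srd}(G)$ is the smallest number of colors of an edge-coloring making $G$ strong rainbow disconnected. *)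

(* Defs.v *)
From HB Require Import structures.
From mathcomp Require Import all_boot.

Set Implicit Arguments.
Unset Strict Implicit.
Unset Printing Implicit Defensive.

Record sgraph := SGraph {
  vertex :> finType;
  adj : rel vertex;
  adj_sym : symmetric adj;
  adj_irrefl : irreflexive adj
}.

Definition connected_graph (G : sgraph) : Prop :=
  forall u v : G, connect (@adj G) u v.

Definition edge_set (G : sgraph) : {set {set G}} :=
  [set [set x; y] | x : G, y : G in adj x].

Definition edge (G : sgraph) : finType := {f : {set G} | f \in edge_set G}.

Section EdgeCuts.
Variable G : sgraph.
Implicit Types (u v : G) (F : {set edge G}).

(* adjacency in G - F *)
Definition del_adj F : rel G :=
  [rel x y | [exists f : edge G, (val f == [set x; y]) && (f \notin F)]].

Definition edge_cut u v F : bool := ~~ connect (del_adj F) u v.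

Definition min_edge_cut u v F : bool :=
  edge_cut u v F && [forall F' : {set edge G}, edge_cut u v F' ==> (#|F| <= #|F'|)].

Definition rainbow k (c : {ffun edge G -> 'I_k}) F : bool :=
  [forall f in F, forall g in F, (c f == c g) ==> (f == g)].

Definition rainbow_disconnected k (c : {ffun edge G -> 'I_k}) : bool :=
  [forall u : G, forall v : G, (u != v) ==>
    [exists F : {set edge G}, edge_cut u v F && rainbow c F]].

Definition strong_rainbow_disconnected k (c : {ffun edge G -> 'I_k}) : bool :=
  [forall u : G, forall v : G, (u != v) ==>
    [exists F : {set edge G}, min_edge_cut u v F && rainbow c F]].

Lemma edge_cutT u v : u != v -> edge_cut u v setT.
Proof.
move=> /eqP uv; apply/negP => /connectP[[|x p]] /=; first by move=> _ /esym.
by case/andP => /existsP[f]; rewrite inE andbF.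
Qed.

Lemma ex_min_edge_cut u v : u != v -> exists F, min_edge_cut u v F.
Proof.
move=> /edge_cutT cT.
case: (@arg_minnP _ setT (edge_cut u v) (fun F => #|F|) cT) => F cF mF.
by exists F; rewrite /min_edge_cut cF; apply/forallP => F'; apply/implyP/mF.
Qed.

Lemma rainbow_enum_rank F : rainbow [ffun f : edge G => enum_rank f] F.
Proof.
apply/forall_inP => f _; apply/forall_inP => g _.
by rewrite !ffunE (inj_eq enum_rank_inj); apply/implyP.
Qed.

Lemma ex_srd :
  exists k, [exists c : {ffun edge G -> 'I_k}, strong_rainbow_disconnected c].
Proof.
exists #|edge G|; apply/existsP; exists [ffun f => enum_rank f].
apply/forallP => u; apply/forallP => v; apply/implyP => /ex_min_edge_cut[F mF].
by apply/existsP; exists F; rewrite mF rainbow_enum_rank.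
Qed.

Lemma ex_rd :
  exists k, [exists c : {ffun edge G -> 'I_k}, rainbow_disconnected c].
Proof.
exists #|edge G|; apply/existsP; exists [ffun f => enum_rank f].
apply/forallP => u; apply/forallP => v; apply/implyP => /edge_cutT cT.
by apply/existsP; exists setT; rewrite cT rainbow_enum_rank.
Qed.

Definition rd : nat := ex_minn ex_rd.

Definition srd : nat := ex_minn ex_srd.

End EdgeCuts.

(* Main.v *)
Require Import Defs.
From HB Require Import structures.
From mathcomp Require Import all_boot.

(** A colouring with a single colour makes exactly the sets of at most one edge
    rainbow.  In a connected graph every edge cut has at least one edge, so a
    rainbow cut for such a colouring is automatically a minimum cut. *)

(** Turns [rd G = 1] and [srd G = 1] into the existence of a good colouring with one colour: [P 1]
    bounds the minimum by 1, and the failure of [P 0] rules out 0. *)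
Lemma ex_minn_eq1 (P : pred nat) (exP : exists n, P n) :
  ~~ P 0 -> ex_minn exP = 1 <-> P 1.
Proof.
move=> nP0; case: ex_minnP => m Pm m_min; split=> [<- // | /m_min].
by case: m Pm {m_min} => [P0 | [|m]] //; rewrite P0 in nP0.
Qed.

(** By contraposition: deleting the empty set keeps every adjacency of [G], so a path from [u] to
    [v] survives. *)
Lemma edge_cut_gt0 {G : sgraph} {u v : G} {F : {set edge G}} :
  connected_graph G -> edge_cut u v F -> 0 < #|F|.
Proof.
move=> conn_G; apply: contraR; rewrite -eqn0Ngt cards_eq0 => /eqP ->.
apply: connect_sub (conn_G u v) => x y xy; apply: connect1.
have xyE : [set x; y] \in edge_set G by apply/imset2P; exists x y; rewrite ?inE.
by apply/existsP; exists (Sub [set x; y] xyE); rewrite SubK eqxx inE.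
Qed.

Lemma strong_rainbow_disconnectedW (G : sgraph) k
    (c : {ffun edge G -> 'I_k}) :
  strong_rainbow_disconnected c -> rainbow_disconnected c.
Proof.
move=> /forallP sc; apply/forallP => u; apply/forallP => v; apply/implyP => uv.
have /existsP[F /andP[/andP[cutF _] rF]] := implyP (forallP (sc u) v) uv.
by apply/existsP; exists F; rewrite cutF.
Qed.

Lemma rainbow1_card_le1 {G : sgraph} {c : {ffun edge G -> 'I_1}}
    {F : {set edge G}} :
  rainbow c F -> #|F| <= 1.
Proof.
move=> /forall_inP rF; apply/card_le1_eqP => f g fF gF.
by have /forall_inP/(_ _ gF)/implyP := rF f fF; rewrite !ord1 => /(_ isT)/eqP.
Qed.

Lemma rainbow_disconnected1_strong (G : sgraph)
    (c : {ffun edge G -> 'I_1}) :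
  connected_graph G ->
  rainbow_disconnected c -> strong_rainbow_disconnected c.
Proof.
move=> conn_G /forallP rc.
apply/forallP => u; apply/forallP => v; apply/implyP => uv.
have /existsP[F /andP[cutF rF]] := implyP (forallP (rc u) v) uv.
apply/existsP; exists F; rewrite /min_edge_cut cutF rF andbT /=.
(* Minimality follows by passing through 1: [#|F| <= 1 <= #|F'|]. *)
apply/forallP => F'; apply/implyP => /(edge_cut_gt0 conn_G).
exact: leq_trans (rainbow1_card_le1 rF).
Qed.

(** Two distinct vertices exist, and a cut between them contains an edge, whose colour would lie in
    the empty type ['I_0]. On a single vertex the condition would hold vacuously. *)
Lemma not_rainbow_disconnected0 {G : sgraph} (c : {ffun edge G -> 'I_0}) :
  1 < #|G| -> connected_graph G -> ~~ rainbow_disconnected c.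
Proof.
move=> /card_gt1P[u [v [_ _ uv]]] conn_G; apply/negP => /forallP rc.
have /existsP[F /andP[cutF _]] := implyP (forallP (rc u) v) uv.
by have /card_gt0P[f _] := edge_cut_gt0 conn_G cutF; case: (c f).
Qed.

Theorem theorem2p8 (G : sgraph) (nontrivial_G : 1 < #|G|)
    (conn_G : connected_graph G) :
  srd G = 1 <-> rd G = 1.
Proof.
have not_rd0 (c : {ffun edge G -> 'I_0}) : ~~ rainbow_disconnected c.
  exact: not_rainbow_disconnected0.
have rd1 : rd G = 1 <->
    [exists c : {ffun edge G -> 'I_1}, rainbow_disconnected c].
  by apply: ex_minn_eq1; rewrite negb_exists; apply/forallP.
have srd1 : srd G = 1 <->
    [exists c : {ffun edge G -> 'I_1}, strong_rainbow_disconnected c].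
  apply: ex_minn_eq1; rewrite negb_exists; apply/forallP => c.
  (* Zero colours fail for the strong notion because they already fail for the weaker one. *)
  exact: contra (@strong_rainbow_disconnectedW _ _ c) (not_rd0 c).
split=> [/srd1 | /rd1] /existsP[c cP]; [apply/rd1 | apply/srd1].
  by apply/existsP; exists c; apply: strong_rainbow_disconnectedW.
by apply/existsP; exists c; apply: rainbow_disconnected1_strong.
Qed.
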